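(* Let $(a_n)_{n\ge 1}$ be an arithmetic sequence with ratios $(q_n)$, and let $x\in\mathbb{T}$ have canonical representation $x=\sum_{n=1}^\infty \frac{c_n}{a_n}$ with respect to $(a_n)$. Then $x$ is a topological $s$-torsion element, i.e. $x\in t^s_{(a_n)}(\mathbb{T})$ (meaning that $a_nx\to 0$ statistically in $\mathbb{T}$), if and only if either $d(\mathrm{supp}(x))=0$, or $\overline{d}(\mathrm{supp}(x))>0$ and for all $A\subseteq\mathbb{N}$ with $\overline{d}(A)>0$ the following hold: (a) If $A$ is $q$-bounded, then: (a1) If $A\subseteq^d \mathrm{supp}(x)$, then $A+1\subseteq^d \mathrm{supp}(x)$, $A\subseteq^d \mathrm{supp}_q(x)$, and there exists $A'\subseteq A$ with $d(A\setminus A')=0$ such that $\lim_{n\in A'}\frac{c_{n+1}+1}{q_{n+1}}=1$ in $\mathbb{R}$. Moreover, if $A+1$ is $q$-bounded, then $A+1\subseteq^d \mathrm{supp}_q(x)$. (a2) If $d(A\cap \mathrm{supp}(x))=0$, then there exists $A'\subseteq A$ with $d(A\setminus A')=0$ such that $\lim_{n\in A'}\frac{c_{n+1}}{q_{n+1}}=0$ in $\mathbb{R}$. Moreover, if $A+1$ is $q$-bounded, then $d((A+1)\cap \mathrm{supp}(x))=0$ as well. (b) If $A$ is $q$-divergent, then $\lim_{n\in B}\frac{c_n}{q_n}=0$ in $\mathbb{T}$ for some $B\subseteq A$ with $d(A\setminus B)=0$.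
   Context: $\mathbb{N}=\{1,2,3,\dots\}$; $\mathbb{T}=\mathbb{R}/\mathbb{Z}$ with its usual compact topology. A limit of real numbers ''$=0$ in $\mathbb{T}$'' means convergence to $0$ of their classes modulo $\mathbb{Z}$ (i.e. the distance to the nearest integer tends to $0$), as opposed to convergence in $\mathbb{R}$. For infinite $A\subseteq\mathbb{N}$, $\lim_{n\in A}$ denotes the limit as $n\to\infty$ with $n\in A$. Density: for $A\subseteq\mathbb{N}$, $\overline{d}(A)=\limsup_{n\to\infty}\frac{|A\cap[0,n-1]|}{n}$ and $\underline{d}(A)=\liminf_{n\to\infty}\frac{|A\cap[0,n-1]|}{n}$; if they agree the common value is the natural density $d(A)$. Write $A\subseteq^d B$ if $d(A\setminus B)=0$. Also $A+1=\{n+1: n\in A\}$. Arithmetic sequence: a sequence of positive integers with $1<a_1<a_2<\cdots$ and $a_n\mid a_{n+1}$ for every $n\in\mathbb{N}$. Put $a_0=1$ and $q_n=a_n/a_{n-1}$ for $n\ge1$. A set $A\subseteq\mathbb{N}$ is $q$-bounded if $(q_n)_{n\in A}$ is bounded, and an infinite $A$ is $q$-divergent if $\lim_{n\in A}q_n=\infty$. Canonical representation: every $x\in\mathbb{T}$ has a unique representation $x=\sum_{n=1}^\infty\frac{c_n}{a_n}$ (modulo $1$) with integers $0\le c_n<q_n$ and $c_n<q_n-1$ for infinitely many $n$. Put $\mathrm{supp}(x)=\{n\in\mathbb{N}: c_n\ne0\}$ and $\mathrm{supp}_q(x)=\{n\in\mathbb{N}: c_n=q_n-1\}$. $a_nx\to0$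 statistically in $\mathbb{T}$ means: for every neighbourhood $U$ of $0$ in $\mathbb{T}$, $d(\{n\in\mathbb{N}: a_nx\notin U\})=0$. $t^s_{(a_n)}(\mathbb{T})$ is the set of all $x\in\mathbb{T}$ with $a_nx\to0$ statistically in $\mathbb{T}$; its elements are the topological $s$-torsion elements. *)

(* Defs.v *)
From HB Require Import structures.
From mathcomp Require Import all_boot all_order all_algebra.
From mathcomp Require Import generic_quotient ring_quotient.
From mathcomp Require Import all_classical all_reals all_analysis.
Set Implicit Arguments.
Unset Strict Implicit.
Unset Printing Implicit Defensive.
Import Order.TTheory GRing.Theory Num.Theory.
Import numFieldNormedType.Exports.

Local Open Scope classical_set_scope.
Local Open Scope ring_scope.

(* Convention: N is {1, 2, ...} ([Npos]). Sequences indexed by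
   n >= 1 are functions on [nat]; for (a_n) the value at 0 is a_0 = 1, for
   (q_n) and (c_n) the value at 0 is never used. *)
Definition Npos : set nat := [set n | (0 < n)%N].

Section Circle.
Variable R : realType.

(* [Num.int_num_subdef] is the predicate underlying [Num.int]; it is the one
   carrying the subgroup structure needed to form the quotient. *)
Definition integers : zmodClosed R :=
  GRing.ZmodClosed.clone R (@Num.int_num_subdef R) _.

(* R / Z with the quotient topology and the quotient group structure. *)
Definition circle : Type := quotient_topology (Quotient.quot integers).

HB.instance Definition _ := Topological.on circle.
HB.instance Definition _ := Quotient.on circle.
HB.instance Definition _ :=
  GRing.Zmodule.copy circle (Quotient.quot integers).

Definition circle_of (r : R) : circle := (\pi_circle r)%qT.

End Circle.

Section Density.
Variable R : realType.
Implicit Types A B : set nat.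

Definition count_ratio A (n : nat) : R :=
  #|[pred i : 'I_n | `[< A (val i) >]]|%:R / n%:R.

Definition upper_density A : R := limn_sup (count_ratio A).
Definition lower_density A : R := limn_inf (count_ratio A).

Definition has_density A (l : R) : Prop :=
  upper_density A = l /\ lower_density A = l.

Definition dsubset A B : Prop := has_density (A `\` B) 0.

End Density.

Definition shift1 (A : set nat) : set nat := [set n.+1 | n in A].

Section Arithmetic.
Implicit Types (a c : nat -> nat) (A : set nat).

Definition arithmetic_sequence a : Prop :=
  [/\ a 0%N = 1%N, forall n, (a n < a n.+1)%N & forall n, (a n %| a n.+1)%N].

Definition qratio a (n : nat) : nat := (a n %/ a n.-1)%N.

Definition q_bounded a A : Prop :=
  exists M : nat, forall n, A n -> (qratio a n <= M)%N.

Definition q_divergent a A : Prop :=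
  infinite_set A /\ qratio a n @[n --> within A \oo] --> \oo.

Definition canonical_rep (R : realType) a (x : circle R) c : Prop :=
  [/\ forall n, Npos n -> (c n < qratio a n)%N,
      infinite_set [set n | Npos n /\ (c n < (qratio a n).-1)%N]
    & exists2 s : R,
        \sum_(1 <= k < n.+1) (c k)%:R / (a k)%:R @[n --> \oo] --> s
      & x = circle_of s].

Definition supp c : set nat := [set n | Npos n /\ c n <> 0%N].

Definition supp_q a c : set nat := [set n | Npos n /\ c n = (qratio a n).-1].

End Arithmetic.

Definition stat_cvg (R : realType) (X : topologicalType) (u : nat -> X)
    (l : X) : Prop :=
  forall U : set X, nbhs l U ->
    has_density [set n | Npos n /\ ~ U (u n)] (0 : R).

Definition s_torsion (R : realType) (a : nat -> nat) : set (circle R) :=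
  [set x : circle R | stat_cvg R (fun n => x *+ a n) (0 : circle R)].

(* Main.v *)
(* Let t_n in [0, 1] represent a_n x; then t_{n-1} = (c_n + t_n) / q_n, so c_n / q_n is within
   1 / q_n of t_{n-1}, and torsion says that t_n is near 0 or 1 outside sets of density zero.
   If t_{n-1} is near an integer and q_n is bounded, then c_n is 0 or q_n - 1 and t_n is near 0,
   respectively 1: this gives (a), while (b) only uses the estimate on c_n / q_n.  Conversely,
   a set of positive upper density on which t_{n-1} stays away from the integers is, up to
   density zero, q-divergent, or else has a q-bounded part of positive upper density.  The first
   contradicts (b).  In the second case (a) moves the set one step to the right, where the
   distance of t to the integers is at least doubled, and iterating is absurd. *)
Require Import Defs.
From mathcomp Require Import all_boot all_order all_algebra.
From mathcomp Require Import generic_quotient ring_quotient.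
From mathcomp Require Import all_classical all_reals all_analysis.
From mathcomp Require Import ring lra zify.
Import Order.TTheory GRing.Theory Num.Theory.
Import numFieldNormedType.Exports.
Set Implicit Arguments.
Unset Strict Implicit.
Unset Printing Implicit Defensive.

Local Open Scope classical_set_scope.
Local Open Scope ring_scope.

(** * Sets of natural density zero *)

Section NullSets.
Variable R : realType.
Implicit Types (A B E : set nat) (n m k : nat).

Definition cnt A n := #|[pred i : 'I_n | `[< A (val i) >]]|.

Lemma cntS A n : cnt A n.+1 = (cnt A n + `[< A n >])%N.
Proof.
rewrite /cnt -!sum1_card !(big_mkcond (fun i => i \in _))/= big_ord_recr/=.
by rewrite !inE/=; case: `[< A n >]; congr addn.
Qed.

Lemma cnt_le_mem A B n :
  (forall m, (m < n)%N -> A m -> B m) -> (cnt A n <= cnt B n)%N.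
Proof.
move=> AB; apply: subset_leq_card; apply/fintype.subsetP => i; rewrite !inE.
exact: (AB _ (ltn_ord i)).
Qed.

Lemma cntU A B n : (cnt (A `|` B) n <= cnt A n + cnt B n)%N.
Proof.
elim: n => [|n IH]; first by rewrite /cnt !eq_card0// => -[].
rewrite !cntS asbool_or; case: `[< A n >]; case: `[< B n >]; rewrite /=; lia.
Qed.

Lemma cnt_leq A n : (cnt A n <= n)%N.
Proof. by rewrite -[leqRHS]card_ord max_card. Qed.

Lemma count_ratio_bounded A n : 0 <= count_ratio R A n <= 1.
Proof.
rewrite /count_ratio divr_ge0//=; case: n => [|n]; first by rewrite mulr0n invr0 mulr0.
by rewrite ler_pdivrMr// mul1r ler_nat cnt_leq.
Qed.

Local Notation null A := (has_density A (0 : R)).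

Lemma density0_cvg A : count_ratio R A @ \oo --> (0 : R) -> null A.
Proof. by move=> /cvg_limn_inf_sup [? ?]; split. Qed.

Lemma upper_density_cvg A : sups (count_ratio R A) @ \oo --> upper_density R A.
Proof.
have ub : has_ubound (range (count_ratio R A)).
  by exists 1 => _ [n _ <-]; case/andP: (count_ratio_bounded A n).
have lb : has_lbound (range (count_ratio R A)).
  by exists 0 => _ [n _ <-]; case/andP: (count_ratio_bounded A n).
have := cvg_sups_inf ub lb; rewrite /upper_density /limn_sup => h.
by apply: cvgP; exact: h.
Qed.

Lemma le_sups_count_ratio A n : 0 <= count_ratio R A n <= sups (count_ratio R A) n.
Proof.
case/andP: (count_ratio_bounded A n) => -> _ /=; apply: ub_le_sup; last by exists n => /=.
by exists 1 => _ [m _ <-]; case/andP: (count_ratio_bounded A m).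
Qed.

(** The ratios are squeezed between 0 and their tail suprema, so a vanishing upper density forces a
    genuine limit, hence lower density 0 as well. *)
Lemma upper_density_eq0 A : upper_density R A = 0 -> null A.
Proof.
move=> A0; apply: density0_cvg; have := @upper_density_cvg A; rewrite A0 => sA.
apply: (squeeze_cvgr _ (cvg_cst 0) sA).
by near=> n; exact: le_sups_count_ratio.
Unshelve. all: by end_near. Qed.

Lemma upper_density_gt0 A : 0 < upper_density R A <-> ~ null A.
Proof.
split => [+ [A0 _]|nA]; first by rewrite A0 ltxx.
rewrite lt_neqAle; apply/andP; split.
  by apply/eqP => A0; apply: nA; exact: upper_density_eq0.
have sA := @upper_density_cvg A; rewrite -(cvg_lim _ sA)//.
apply: limr_ge; first exact: cvgP sA.
by near=> n; case/andP: (le_sups_count_ratio A n); exact: le_trans.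
Unshelve. all: by end_near. Qed.

(** Division-free form of density zero, in which unions, shifts and finite sets become estimates on
    [cnt]. *)
Lemma density0P A : null A <->
  forall e : R, 0 < e -> exists N, forall n, (N <= n)%N -> (cnt A n)%:R <= e * n%:R.
Proof.
split => [[A0 _] e e0|Ae].
  have := @upper_density_cvg A; rewrite A0 => /cvgrPdist_lt /(_ _ e0) [N _ NA].
  exists N => -[|n] Nn; first by rewrite mulr0 /cnt eq_card0// => -[].
  have := NA _ Nn; rewrite /= sub0r normrN; move/(le_lt_trans (ler_norm _)).
  case/andP: (le_sups_count_ratio A n.+1) => _ /le_lt_trans /[apply].
  by rewrite /count_ratio ltr_pdivrMr// => /ltW.
apply: density0_cvg; apply/cvgrPdist_le => e e0.
have [N AN] := Ae e e0; exists N => // n /AN h.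
rewrite sub0r normrN ger0_norm; last by case/andP: (count_ratio_bounded A n).
case: n h => [|n] h; last by rewrite ler_pdivrMr.
by rewrite /count_ratio mulr0n invr0 mulr0 ltW.
Qed.

Lemma density0_subset A B : A `<=` B -> null B -> null A.
Proof.
move=> AB /density0P nB; apply/density0P => e /nB [N BN]; exists N => n /BN; apply: le_trans.
by rewrite ler_nat; apply: cnt_le_mem => m _; exact: AB.
Qed.

Lemma density0_setU A B : null A -> null B -> null (A `|` B).
Proof.
move=> /density0P nA /density0P nB; apply/density0P => e e0.
have e20 : 0 < e / 2 by rewrite divr_gt0.
have [[M AM] [N BN]] := (nA _ e20, nB _ e20).
exists (maxn M N) => n; rewrite geq_max => /andP[/AM hA /BN hB].
rewrite (splitr e) mulrDl; apply: le_trans (lerD hA hB).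
by rewrite -natrD ler_nat cntU.
Qed.

Lemma density0_initial N : null [set n | (n < N)%N].
Proof.
have cntN n : (cnt [set n | (n < N)%N] n <= N)%N.
  elim: n => [|n IH]; first by rewrite /cnt eq_card0// => -[].
  rewrite cntS; case: asboolP => [/= nN|_]; last by rewrite addn0.
  by rewrite addn1 (leq_ltn_trans (cnt_leq _ _)).
apply/density0P => e e0; exists (Num.truncn (N%:R / e)).+1 => n nN.
rewrite (le_trans (_ : _ <= N%:R))// ?ler_nat// -ler_pdivrMl// mulrC ltW//.
by rewrite (lt_le_trans (truncnS_gt _))// ler_nat.
Qed.

Lemma density0_shift1 A : null (shift1 A) <-> null A.
Proof.
have cnt_shift n : cnt (shift1 A) n.+1 = cnt A n.
  elim: n => [|n IH].
    by rewrite cntS /cnt !eq_card0 => [|[]//|[]//]; case: asboolP => // -[].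
  rewrite cntS IH cntS; congr (_ + nat_of_bool _)%N; apply: asbool_equiv_eq.
  by split => [[m Am [<-]]|An] //; exists n.
split => /density0P nA; apply/density0P => e e0.
  have e20 : 0 < e / 2 by rewrite divr_gt0.
  (* Halving [e] absorbs the change of index, as [n + 2 <= 2 * (n + 1)]. *)
  have [N AN] := nA _ e20; exists N.+1 => -[//|n] Nn.
  have := AN n.+2 (leq_trans (ltnW Nn) (leqnSn _)).
  rewrite cnt_shift => /le_trans; apply.
  rewrite mulrAC ler_pdivrMr// -mulrA ler_pM2l// -natrM ler_nat; lia.
have [N AN] := nA _ e0; exists N.+1 => -[//|n] Nn.
rewrite cnt_shift (le_trans (AN n Nn))// ler_wpM2l ?ler_nat//; exact: ltW.
Qed.

Lemma density_neq0_almost A B : ~ null A -> null (A `\` B) -> ~ null B.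
Proof.
move=> nA nAB nB; apply: nA; apply: density0_subset (density0_setU nAB nB) => n An.
by have [Bn|Bn] := pselect (B n); [right|left].
Qed.

Lemma density_neq0_setI A B : ~ null A -> null (A `\` B) -> ~ null (A `&` B).
Proof. by move=> nA nAB; apply: density_neq0_almost nA _; rewrite setDIr setDv set0U. Qed.

Lemma density_neq0_setD A B : ~ null A -> null (A `&` B) -> ~ null (A `\` B).
Proof. by rewrite -{1}(setDD A B); exact: density_neq0_almost. Qed.

Lemma density_neq0_unbounded A : ~ null A -> forall N, exists2 n, A n & (N <= n)%N.
Proof.
move=> nA N; apply: contrapT => h; apply: nA; apply: density0_subset (density0_initial N).
by move=> n An /=; rewrite ltnNge; apply/negP => Nn; apply: h; exists n.
Qed.

Lemma density_neq0_infinite A : ~ null A -> infinite_set A.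
Proof.
move=> /density_neq0_unbounded nA /finite_seqP[s As].
have [n] := nA (\max_(i <- s) i).+1; rewrite As ltnNge => /= ns /negP; apply.
exact: leq_bigmax_seq.
Qed.

(* Diagonal argument: [n] is removed from [A] when it lies in some [E j], [j <= k],
   for which the density of [E 0 `|` ... `|` E k] beyond [n] is already below [1 / (k + 1)]. *)
Lemma density0_diagonal A (E : nat -> set nat) : (forall k, null (A `&` E k)) ->
  exists A', [/\ A' `<=` A, null (A `\` A') &
    forall k, exists N, forall n, (N <= n)%N -> A' n -> ~ E k n].
Proof.
move=> nE; pose F k := [set n | A n /\ exists2 j, (j <= k)%N & E j n].
have nF k : null (F k).
  elim: k => [|k IH].
    by apply: density0_subset (nE 0%N) => n [An [j]]; rewrite leqn0 => /eqP ->.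
  apply: density0_subset (density0_setU IH (nE k.+1)) => n [An [j]].
  by rewrite leq_eqVlt => /predU1P[->|jk] Ejn; [right|left; split=> //; exists j].
have /choice [M MF] : forall k, exists N, forall n, (N <= n)%N ->
    (cnt (F k) n)%:R <= k.+1%:R^-1 * n%:R :> R.
  by move=> k; have /density0P := nF k; apply; rewrite invr_gt0.
(* Since [N k >= k], only finitely many [k] satisfy [N k <= n]; for the largest such [K], all of [D]
   below [n] lies in [F K]. *)
pose N k := maxn k (M k).
pose D := [set n | exists2 k, (N k <= n)%N & F k n].
exists (A `\` D); split => [n []//||k]; last first.
  by exists (N k) => n Nn [An nD] Ekn; apply: nD; exists k => //; split => //; exists k.
apply: (@density0_subset _ D) => [n [An]|].
  by move=> h; apply: contrapT => nD; apply: h.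
apply/density0P => e e0; pose k0 := Num.truncn e^-1.
exists (N k0) => n k0n.
have exN : exists k, (N k <= n)%N by exists k0.
have bN k : (N k <= n)%N -> (k <= n)%N by apply: leq_trans; exact: leq_maxl.
have [K Kn Kmax] := ex_maxnP exN bN.
have le_cnt : (cnt D n <= cnt (F K) n)%N.
  apply: cnt_le_mem => m mn [k km [Am [j jk Ejm]]]; split => //; exists j => //.
  by rewrite (leq_trans jk)// Kmax// (leq_trans km)// ltnW.
have := MF K n (leq_trans (leq_maxr _ _) Kn).
move=> /(le_trans _) h; apply: (le_trans (h _ _)); first by rewrite ler_nat.
rewrite ler_wpM2r// invf_ple ?posrE// (le_trans (ltW (truncnS_gt _)))//.
by rewrite ler_nat ltnS Kmax.
Qed.

End NullSets.

(** * The circle and nearness to the integers *)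

Section CircleTheory.
Variable R : realType.
Implicit Types r s d e : R.

Lemma circle_of_eq r s : circle_of r = circle_of s <-> r - s \is a Num.int.
Proof.
rewrite (_ : (r - s \is a Num.int) = (r - s \in integers R)) //.
rewrite (@Quotient.idealrBE R (integers R) r s); by split => [h|/eqP]; first by apply/eqP.
Qed.

Lemma circle_ofD r s : circle_of (r + s) = circle_of r + circle_of s.
Proof. exact: (@pi_addr R _ _ _ _ (Quotient.quot (integers R))). Qed.

Lemma circle_of0 : circle_of (0 : R) = 0.
Proof. exact: (@pi_zeror R _ _ _ _ (Quotient.quot (integers R))). Qed.

Lemma circle_ofMn r n : circle_of (r *+ n) = circle_of r *+ n.
Proof. by elim: n => [|n IH]; rewrite ?mulr0n ?circle_of0// !mulrS circle_ofD IH. Qed.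

(* For [r] in [0, 1] only, this says that [r] is at distance less than [e] from an integer. *)
Definition near_int e r := r < e \/ 1 - e < r.

Lemma near_int_close d e r s :
  `|r - s| <= d -> d + d <= e -> near_int d r -> near_int e s.
Proof. by rewrite ler_norml /near_int => /andP[h1 h2] de []; [left|right]; lra. Qed.

(** Continuity of the projection pulls [U] back to a ball around 0; a point near 1 enters that ball
    after subtracting 1, which keeps its class. *)
Lemma nbhs_circle_of0 (U : set (circle R)) : nbhs (0 : circle R) U ->
  exists2 e, 0 < e & forall r, 0 <= r <= 1 -> near_int e r -> U (circle_of r).
Proof.
rewrite -circle_of0 => /pi_continuous; rewrite nbhs_simpl => /nbhs_ballP [e e0 eU].
exists e => // r /andP[r0 r1] [re|re].
  by apply: eU => /=; rewrite /ball/= sub0r normrN ger0_norm.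
rewrite (_ : circle_of r = circle_of (r - 1)).
  by apply: eU => /=; rewrite /ball/= sub0r normrN ler0_norm; lra.
by apply/circle_of_eq; rewrite opprB addrC subrK; exact: int_num1.
Qed.

(** The projection of a ball is open because its preimage is the union of the integer translates of
    that ball. *)
Lemma near_int_nbhs_circle e : 0 < e ->
  exists2 U : set (circle R), nbhs (0 : circle R) U &
    forall r, 0 <= r <= 1 -> U (circle_of r) -> near_int e r.
Proof.
move=> e0; exists (@circle_of R @` ball (0 : R) e).
  rewrite nbhsE/=; exists (@circle_of R @` ball (0 : R) e) => //; split.
    change (open (@circle_of R @^-1` (@circle_of R @` ball (0 : R) e))).
    rewrite (_ : _ @^-1` _ = \bigcup_(z in [set z : R | z \is a Num.int]) ball (z : R) e).
      by apply: bigcup_open => z _; exact: ball_open.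
    apply/seteqP; split => r /=.
      move=> [s sb /esym/circle_of_eq rs]; exists (r - s) => //=.
      move: sb; rewrite /ball/= sub0r normrN.
      by rewrite addrAC subrr sub0r normrN.
    move=> [z zi] rb; exists (r - z).
      by move: rb; rewrite /ball/= sub0r opprB.
    by apply/circle_of_eq; rewrite addrAC subrr sub0r rpredN.
  by exists 0; [exact: ballxx|exact: circle_of0].
move=> r /andP[r0 r1] [s]; rewrite /ball/= sub0r normrN => se /esym/circle_of_eq.
move=> /intrP [z rsz]; rewrite /near_int.
(* The integer [z] is within [e] of [r]: if [z <= 0] then [r] is near 0, and if [z >= 1] then [r] is
   near 1. *)
have [z0|z0] := lerP z%:~R (0 : R).
  by left; move: se; rewrite ltr_norml => /andP[]; lra.
right; have z1 : 1 <= z%:~R :> R by rewrite ler1z; move: z0; rewrite ltr0z.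
by move: se; rewrite ltr_norml => /andP[]; lra.
Qed.

Lemma cvg_circle_of0 (F : set_system nat) (f : nat -> R) : Filter F ->
  (forall n, 0 <= f n <= 1) ->
  circle_of (f n) @[n --> F] --> (0 : circle R) <->
  forall e, 0 < e -> \forall n \near F, near_int e (f n).
Proof.
move=> FF f01; split => [fc e e0|fe U].
  have [U /fc U0 Ue] := near_int_nbhs_circle e0.
  exact: filterS (fun n => Ue _ (f01 n)) U0.
move=> /nbhs_circle_of0 [e /fe eF eU]; exact: filterS (fun n => eU _ (f01 n)) eF.
Qed.

Lemma cvgn_withinP (D : set nat) (f : nat -> R) l :
  f n @[n --> within D \oo] --> l <->
  forall e, 0 < e -> exists N, forall n, (N <= n)%N -> D n -> `|l - f n| < e.
Proof.
rewrite cvgrPdist_lt; split => fl e /fl.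
  by move=> [N _ NE]; exists N => n /NE; exact.
by move=> [N NE]; exists N => // n /NE; exact.
Qed.

End CircleTheory.

(** * From statistical limits to limits along subsets with null complement *)

Section StatisticalLimits.
Variable R : realType.
Local Notation null A := (has_density A (0 : R)).

Lemma ltr_invS (e : R) : 0 < e -> exists k : nat, k.+1%:R^-1 < e.
Proof.
move=> e0; exists (Num.truncn e^-1).
by rewrite invf_plt ?posrE// truncnS_gt.
Qed.

(** Diagonal argument over the tolerances [1 / (k + 1)]; it produces the sets [A'] of (a1) and
    (a2). *)
Lemma density0_cvg_within (A : set nat) (f : nat -> R) l :
  (forall e : R, 0 < e -> null (A `&` [set n | ~ `|l - f n| < e])) ->
  exists A', [/\ A' `<=` A, null (A `\` A') & f n @[n --> within A' \oo] --> l].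
Proof.
move=> nf.
have nE k : null (A `&` [set n | ~ `|l - f n| < k.+1%:R^-1]).
  by apply: nf; rewrite invr_gt0.
have [A' [A'A nA' A'E]] := density0_diagonal nE.
exists A'; split => //; apply/cvgn_withinP => e /ltr_invS [k ke].
have [N NA] := A'E k; exists N => n Nn A'n.
by apply: lt_trans ke; apply: contrapT; exact: NA.
Qed.

Lemma density0_predset (P : set nat) : null P -> null [set n | P n.+1].
Proof.
move=> nP; apply: (iffLR (density0_shift1 _ _)).
by apply: density0_subset nP => _ [n /= Pn <-].
Qed.

End StatisticalLimits.

(** * Digits and tails under the recursion [t_rec] *)

(* [t n] plays the role of the representative of [a n x] in [0, 1]. *)
Section DigitDynamics.
Variables (R : realType) (a c : nat -> nat) (t : nat -> R).
Local Notation q := (qratio a).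
Local Notation null A := (has_density A (0 : R)).
Hypothesis q_gt1 : forall n, (0 < n)%N -> (1 < q n)%N.
Hypothesis c_ltq : forall n, (0 < n)%N -> (c n < q n)%N.
Hypothesis t01 : forall n, 0 <= t n <= 1.
Hypothesis t_rec : forall n, t n = ((c n.+1)%:R + t n.+1) / (q n.+1)%:R.
Implicit Types (A S : set nat) (n k M : nat) (e d : R).

Lemma q_pos n : (0 < n)%N -> (0 : R) < (q n)%:R.
Proof. by move=> /q_gt1 /ltnW; rewrite ltr0n. Qed.

Lemma t_predM n : (0 < n)%N -> t n.-1 * (q n)%:R = (c n)%:R + t n.
Proof. by case: n => // n _; rewrite t_rec/= divfK// gt_eqF ?q_pos. Qed.

Lemma digit_le_t n : (0 < n)%N -> (c n)%:R / (q n)%:R <= t n.-1.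
Proof.
move=> n0; rewrite ler_pdivrMr ?q_pos// t_predM// lerDl.
by case/andP: (t01 n).
Qed.

Lemma t_le_digit n : (0 < n)%N -> t n.-1 <= (c n).+1%:R / (q n)%:R.
Proof.
move=> n0; rewrite ler_pdivlMr ?q_pos// t_predM// -natr1 lerD2l.
by case/andP: (t01 n).
Qed.

Lemma t_digit_dist n : (0 < n)%N -> `|t n.-1 - (c n)%:R / (q n)%:R| <= (q n)%:R^-1.
Proof.
move=> n0; rewrite ger0_norm ?subr_ge0 ?digit_le_t// lerBlDl.
by have := t_le_digit n0; rewrite -natr1 mulrDl mul1r.
Qed.

Lemma digitS_le1 n : (0 < n)%N -> (c n).+1%:R / (q n)%:R <= 1 :> R.
Proof. by move=> n0; rewrite ler_pdivrMr ?q_pos// mul1r ler_nat c_ltq. Qed.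

(** Multiplying by [q n] turns [t n.-1] into [c n + t n] and the tolerance into at most [d]. A
    nonzero digit rules out the end 0, and closeness to [q n] leaves only the top digit. *)
Lemma supp_near_int d M n : 0 < d <= 1 -> (0 < n)%N -> (q n <= M)%N -> c n <> 0%N ->
  near_int (d / M%:R) (t n.-1) -> c n = (q n).-1 /\ 1 - d < t n.
Proof.
move=> /andP[d0 d1] n0 qM c0 tn.
have q0 := q_pos n0; have tM := t_predM n0; have /andP[tn0 tn1] := t01 n.
have qMR : (q n)%:R <= M%:R :> R by rewrite ler_nat.
have M0 := lt_le_trans q0 qMR.
have qd : d / M%:R * (q n)%:R <= d.
  by rewrite -mulrA ger_pMr// ler_pdivrMl// mulr1.
have c1 : 1 <= (c n)%:R :> R by rewrite ler1n lt0n; exact/eqP.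
case: tn; rewrite -(ltr_pM2r q0) tM ?mulrBl ?mul1r => tn; first by lra.
have cq : c n = (q n).-1.
  have : (q n)%:R < (c n)%:R + 2 :> R by lra.
  by rewrite -natrD ltr_nat; have := c_ltq n0; lia.
split=> //; move: tn; have -> : (q n)%:R = (c n)%:R + 1 :> R.
  by rewrite cq natr1 prednK// ltnW// q_gt1.
move: qd; have -> : (q n)%:R = (c n)%:R + 1 :> R.
  by rewrite cq natr1 prednK// ltnW// q_gt1.
by lra.
Qed.

(** Here [t n.-1 * q n = t n]; the end 1 would give [t n > q n - d >= 1], which is impossible. *)
Lemma zero_near_int d M n : 0 < d <= 1 -> (0 < n)%N -> (q n <= M)%N -> c n = 0%N ->
  near_int (d / M%:R) (t n.-1) -> t n < d.
Proof.
move=> /andP[d0 d1] n0 qM c0 tn.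
have q0 := q_pos n0; have tM := t_predM n0; have /andP[tn0 tn1] := t01 n.
rewrite c0 add0r in tM.
have qMR : (q n)%:R <= M%:R :> R by rewrite ler_nat.
have M0 := lt_le_trans q0 qMR.
have q2 : 2 <= (q n)%:R :> R by rewrite ler_nat q_gt1.
have qd : d / M%:R * (q n)%:R <= d.
  by rewrite -mulrA ger_pMr// ler_pdivrMl// mulr1.
case: tn; rewrite -(ltr_pM2r q0) tM ?mulrBl ?mul1r; lra.
Qed.

Lemma supp_q_supp : supp_q a c `<=` supp c.
Proof. by move=> n [n0 cn]; split => //; rewrite cn; have := q_gt1 n0; lia. Qed.

Lemma shift1_Npos A : shift1 A `<=` Npos.
Proof. by move=> _ [n _ <-]. Qed.

Lemma cvg_circle_digit A : A `<=` Npos ->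
  circle_of ((c n)%:R / (q n)%:R : R) @[n --> within A \oo] --> (0 : circle R) <->
  forall e, 0 < e -> \forall n \near within A \oo, near_int e ((c n)%:R / (q n)%:R).
Proof.
(* The extra factor only changes index 0, where the quotient is unconstrained and might leave
   [0, 1]. *)
move=> A0; pose f n := (c n)%:R / (q n)%:R * (n != 0%N)%:R : R.
have f01 n : 0 <= f n <= 1.
  rewrite /f; case: n => [|n]; first by rewrite mulr0 lexx ler01.
  rewrite mulr1 divr_ge0//= ler_pdivrMr ?q_pos// mul1r ler_nat.
  by rewrite ltnW// c_ltq.
have fE n : A n -> f n = (c n)%:R / (q n)%:R.
  by move=> /A0; rewrite /f /Npos/= lt0n => ->; rewrite mulr1.
have -> : circle_of ((c n)%:R / (q n)%:R : R) @[n --> within A \oo] --> (0 : circle R) <->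
    circle_of (f n) @[n --> within A \oo] --> (0 : circle R).
  by split=> h; apply: cvg_trans h; apply: near_eq_cvg; exists 0%N => // n _ /fE ->.
apply: iff_trans (cvg_circle_of0 _ f01) _.
by split=> h e /h [N _ hN]; exists N => // n /hN + An => /(_ An); rewrite fE.
Qed.

(** * Digit conditions derived from statistical convergence *)

Section Forward.
Hypothesis t_stat : forall e, 0 < e -> null [set n | ~ near_int e (t n.-1)].

Lemma stat_supp A d : A `<=` Npos -> q_bounded a A -> null (A `\` supp c) -> 0 < d <= 1 ->
  null (A `&` [set n | ~ (c n = (q n).-1 /\ 1 - d < t n)]).
Proof.
move=> A0 [M AM] nA d01.
(* The successor keeps the denominator positive even if the bound [M] is 0. *)
have dM : 0 < d / M.+1%:R by rewrite divr_gt0//; case/andP: d01.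
apply: density0_subset (density0_setU nA (t_stat dM)) => n [An bad].
have [cn|cn] := pselect (supp c n); last by left.
right=> tn; apply: bad; case: cn => _ cn.
by apply: (supp_near_int d01 (A0 _ An) _ cn tn); exact: leqW (AM _ An).
Qed.

Lemma stat_zero A d : A `<=` Npos -> q_bounded a A -> null (A `&` supp c) -> 0 < d <= 1 ->
  null (A `&` [set n | ~ (t n < d)]).
Proof.
move=> A0 [M AM] nA d01.
have dM : 0 < d / M.+1%:R by rewrite divr_gt0//; case/andP: d01.
apply: density0_subset (density0_setU nA (t_stat dM)) => n [An bad].
have [cn|cn] := pselect (supp c n); first by left.
right=> tn; apply: bad; apply: (zero_near_int d01 (A0 _ An) _ _ tn).
  exact: leqW (AM _ An).
by apply: contrapT => cn0; apply: cn; split => //; exact: A0.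
Qed.

Lemma stat_supp_q A : A `<=` Npos -> q_bounded a A -> null (A `\` supp c) ->
  null (A `\` supp_q a c).
Proof.
move=> A0 bA nA.
have d1 : 0 < (1 : R) <= 1 by rewrite ltr01 lexx.
apply: density0_subset (stat_supp A0 bA nA d1) => n [An nq]; split => // -[cn _].
by apply: nq; split => //; exact: A0.
Qed.

(** If [c n.+1] were 0, then [t n <= 1 / q n.+1 <= 1 / 2]; tolerance 1/2 in [stat_supp] excludes
    this outside a null set. *)
Lemma stat_supp_shift A : A `<=` Npos -> q_bounded a A -> null (A `\` supp c) ->
  null (shift1 A `\` supp c).
Proof.
move=> A0 bA nA.
have d1 : 0 < (2^-1 : R) <= 1 by lra.
apply: density0_subset (iffRL (density0_shift1 _ _) (stat_supp A0 bA nA d1)).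
move=> _ [[n An <-] nq]; exists n => //; split => // -[_ tn]; apply: nq; split => // cn.
have := t_le_digit (ltn0Sn n); rewrite cn /= => tq; move: tn; apply/negP; rewrite -leNgt.
apply: (le_trans tq); rewrite ler_pdivrMr ?q_pos//.
have : 2 <= (q n.+1)%:R :> R by rewrite ler_nat q_gt1.
by lra.
Qed.

(** The quotient is squeezed between [t n], which [stat_supp] puts close to 1, and 1 itself. *)
Lemma stat_supp_cvg A : A `<=` Npos -> q_bounded a A -> null (A `\` supp c) ->
  exists A', [/\ A' `<=` A, null (A `\` A') &
    (c n.+1).+1%:R / (q n.+1)%:R @[n --> within A' \oo] --> (1 : R)].
Proof.
move=> A0 bA nA; apply: density0_cvg_within => e e0.
have d01 : 0 < Num.min e 1 <= 1 by rewrite lt_min e0 ltr01 ge_min lexx orbT.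
apply: density0_subset (stat_supp A0 bA nA d01) => n [An far]; split => // -[_ tn].
apply: far; have /= tq := t_le_digit (ltn0Sn n); have q1 := digitS_le1 (ltn0Sn n).
rewrite ger0_norm ?subr_ge0// ltrBlDl -ltrBlDr (le_lt_trans _ (lt_le_trans tn tq))//.
by rewrite lerD2l lerN2 ge_min lexx.
Qed.

Lemma stat_zero_cvg A : A `<=` Npos -> q_bounded a A -> null (A `&` supp c) ->
  exists A', [/\ A' `<=` A, null (A `\` A') &
    (c n.+1)%:R / (q n.+1)%:R @[n --> within A' \oo] --> (0 : R)].
Proof.
move=> A0 bA nA; apply: density0_cvg_within => e e0.
have d01 : 0 < Num.min e 1 <= 1 by rewrite lt_min e0 ltr01 ge_min lexx orbT.
apply: density0_subset (stat_zero A0 bA nA d01) => n [An far]; split => // tn.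
apply: far; have /= tq := digit_le_t (ltn0Sn n).
rewrite sub0r normrN ger0_norm// (le_lt_trans tq)// (lt_le_trans tn)//.
by rewrite ge_min lexx.
Qed.

Lemma stat_zero_shift A : A `<=` Npos -> q_bounded a A -> q_bounded a (shift1 A) ->
  null (A `&` supp c) -> null (shift1 A `&` supp c).
Proof.
move=> A0 bA [M AM] nA.
(* From [q n.+1 <= M] and [c n.+1 / q n.+1 <= t n < 1 / (M + 1)] the digit [c n.+1] is less than
   1. *)
have d01 : 0 < (M.+1%:R^-1 : R) <= 1 by rewrite invr_gt0 ltr0n invf_le1// ler1n.
apply: density0_subset (iffRL (density0_shift1 _ _) (stat_zero A0 bA nA d01)).
move=> _ [[n An <-] [_ cn]]; exists n => //; split => // tn; apply: cn.
have := le_lt_trans (digit_le_t (ltn0Sn n)) tn.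
rewrite ltr_pdivrMr ?q_pos// ltr_pdivlMl// -natrM ltr_nat.
by have := AM n.+1 (ex_intro2 _ _ n An erefl); case: (c n.+1) => // k; nia.
Qed.

Lemma stat_divergent A : A `<=` Npos -> q n @[n --> within A \oo] --> \oo ->
  exists B, [/\ B `<=` A, null (A `\` B) &
    circle_of ((c n)%:R / (q n)%:R : R) @[n --> within B \oo] --> (0 : circle R)].
Proof.
move=> A0 qA.
have nE k : null (A `&` [set n | ~ near_int (k.+1%:R^-1) (t n.-1)]).
  by apply: density0_subset (t_stat (_ : 0 < k.+1%:R^-1)) => [n []//|]; rewrite invr_gt0.
have [B [BA nB BE]] := density0_diagonal nE; exists B; split => //.
apply/(cvg_circle_digit (subset_trans BA A0)) => e e0.
have e20 : 0 < e / 2 by rewrite divr_gt0.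
(* One [k] serves twice: [1 / (k + 1)] is the tolerance on [t n.-1] and, once [q n > k], a bound on
   its distance to [c n / q n]. *)
have [k ke] := ltr_invS e20; have [N BN] := BE k.
have /cvgnyPge/(_ k.+1) [N' _ qN] := qA.
exists (maxn N N') => // n; rewrite /= geq_max => /andP[Nn N'n] Bn.
have An := BA _ Bn; have n0 := A0 _ An.
apply: near_int_close (contrapT (BN n Nn Bn)); last by rewrite (splitr e) lerD// ltW.
by apply: le_trans (t_digit_dist n0) _; rewrite lef_pV2 ?posrE ?q_pos// ler_nat; exact: qN.
Qed.

End Forward.

(** * Statistical convergence derived from digit conditions *)

(** At a zero digit [t n = t n.+1 / q n.+1], so [t n.+1 <= 1 / (k + 1)] gives [t n <= 1 / (k + 2)].
    Each induction step thus only adds a shifted copy of the null support to the exceptions. *)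
Lemma density0_supp_stat : null (supp c) -> forall e, 0 < e -> null [set n | ~ near_int e (t n)].
Proof.
move=> ns e e0.
have nk k : null [set n | ~ (t n <= k.+1%:R^-1)].
  elim: k => [|k IH].
    apply: density0_subset (density0_initial R 0%N) => n /=; case/andP: (t01 n) => _.
    by rewrite invr1 => ->.
  apply: density0_subset (density0_predset (density0_setU ns IH)) => n /= tn.
  have [cn|cn] := pselect (supp c n.+1); [by left|right => tn1; apply: tn].
  have c0 : c n.+1 = 0%N by apply: contrapT => c0; apply: cn.
  rewrite t_rec c0 add0r ler_pdivrMr ?q_pos// (le_trans tn1)//.
  rewrite mulrC ler_pdivlMr// ler_pdivrMl// -natrM ler_nat.
  by have := q_gt1 (ltn0Sn n); nia.
have [k ke] := ltr_invS e0; apply: density0_subset (nk k) => n far tn; apply: far.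
by left; exact: le_lt_trans ke.
Qed.

(* Both halves of (a) feed this descent: with [D = supp_q a c] and [u = 1 - t], or with [D] the
   zero digits and [u = t], a step inside [D] halves [u], while leaving the bounded part of [q]
   makes [u] small at once. *)
Lemma descent (u r : nat -> R) (D : set nat) : D `<=` Npos ->
  (forall n, u n <= 1) ->
  (forall n, D n -> u n.-1 <= u n / 2) ->
  (forall n, u n <= r n + (q n.+1)%:R^-1) ->
  (forall S, S `<=` D -> ~ null S -> q_bounded a S ->
    (exists S', [/\ S' `<=` S, null (S `\` S') & r n @[n --> within S' \oo] --> (0 : R)]) /\
    (q_bounded a (shift1 S) -> null (shift1 S `\` D))) ->
  forall k S, S `<=` D -> ~ null S -> q_bounded a S -> exists2 n, S n & u n.-1 <= 2^-1 ^+ k.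
Proof.
move=> D0 u1 uD ur hyp; elim=> [|k IH] S SD nS bS.
  by have [n Sn _] := density_neq0_unbounded nS 0; exists n => //; rewrite expr0.
suff [n Sn un] : exists2 n, S n & u n <= 2^-1 ^+ k.
  by exists n => //; have := uD n (SD n Sn); rewrite exprSr; lra.
have pk : (0 : R) < 2^-1 ^+ k by rewrite exprn_gt0.
have [j jk] : exists j : nat, j.+1%:R^-1 < 2^-1 ^+ k / 2 :> R by apply: ltr_invS; lra.
have [[S' [S'S nS' rS']] _] := hyp S SD nS bS.
(* If [q n.+1 <= j] is exceptional on [S'], a late [n] in [S'] has both terms of [ur] below half the
   target. Otherwise these [n] form a non-null [T] with [q]-bounded shift, almost inside [D], to
   which the induction hypothesis applies. *)
have [nb|nb] := pselect (null (S' `&` [set n | (q n.+1 <= j)%N])).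
  have /cvgn_withinP/(_ (2^-1 ^+ k / 2)) [|N rN] := rS'; first by lra.
  have nS2 := density_neq0_almost nS nS'.
  have [n [S'n /= /negP qn] Nn] := density_neq0_unbounded (density_neq0_setD nS2 nb) N.
  exists n; first exact: S'S.
  have := rN n Nn S'n; rewrite sub0r normrN => /(le_lt_trans (ler_norm _)) rn.
  have qj : (q n.+1)%:R^-1 <= j.+1%:R^-1 :> R.
    by rewrite lef_pV2 ?posrE ?q_pos// ler_nat ltnNge.
  rewrite (le_trans (ur n))// [leRHS]splitr lerD// ltW// (le_lt_trans qj)//.
set T := S' `&` _ in nb.
have TS : T `<=` S by move=> n [/S'S].
have bT : q_bounded a T.
  by have [M SM] := bS; exists M => n /TS/SM.
have bT1 : q_bounded a (shift1 T) by exists j => _ [n [_ qn] <-].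
have [_ /(_ bT1) nTD] := hyp T (subset_trans TS SD) nb bT.
have nTD' := density_neq0_setI (fun h => nb (iffLR (density0_shift1 _ _) h)) nTD.
have [||_ [[n Tn <-] _] un] := IH (shift1 T `&` D) _ nTD'.
- by move=> n [].
- by have [M TM] := bT1; exists M => n [/TM].
by exists n => //; exact: TS.
Qed.

(** This is (a1) for a single set [A]; the next two definitions are (a2) and (b). *)
Definition cond_supp A : Prop := null (A `\` supp c) ->
  [/\ null (shift1 A `\` supp c), null (A `\` supp_q a c),
      exists A', [/\ A' `<=` A, null (A `\` A') &
        (c n.+1).+1%:R / (q n.+1)%:R @[n --> within A' \oo] --> (1 : R)]
    & q_bounded a (shift1 A) -> null (shift1 A `\` supp_q a c)].

Definition cond_zero A : Prop := null (A `&` supp c) ->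
  (exists A', [/\ A' `<=` A, null (A `\` A') &
     (c n.+1)%:R / (q n.+1)%:R @[n --> within A' \oo] --> (0 : R)]) /\
  (q_bounded a (shift1 A) -> null (shift1 A `&` supp c)).

Definition cond_divergent A : Prop := q_divergent a A ->
  exists B, [/\ B `<=` A, null (A `\` B) &
    circle_of ((c n)%:R / (q n)%:R : R) @[n --> within B \oo] --> (0 : circle R)].

(** By (a1), [S] lies in [supp_q a c] up to a null set, and there [1 - t n.-1 = (1 - t n) / q n]. So
    [descent] applies to [1 - t], the limit in (a1) making [r] small. *)
Lemma exists_small_supp :
  (forall A, A `<=` Npos -> ~ null A -> q_bounded a A -> cond_supp A) ->
  forall k S, S `<=` supp c -> ~ null S -> q_bounded a S ->
    exists2 n, S n & 1 - t n.-1 <= 2^-1 ^+ k.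
Proof.
move=> cond k S Ss nS bS.
have nullD0 A B : A `<=` B -> null (A `\` B).
  by move=> AB; apply: density0_subset (density0_initial R 0%N) => n [/AB].
have [_ nSq _ _] : _ := cond S (fun n Sn => (Ss n Sn).1) nS bS (nullD0 _ _ Ss).
have nSI := density_neq0_setI nS nSq.
have [n [Sn _] tn] : exists2 n, (S `&` supp_q a c) n & 1 - t n.-1 <= 2^-1 ^+ k;
  last by exists n.
have bSI : q_bounded a (S `&` supp_q a c).
  by have [M SM] := bS; exists M => n [/SM].
apply: (descent (u := fun n => 1 - t n)
    (r := fun n => 1 - (c n.+1).+1%:R / (q n.+1)%:R) (D := supp_q a c)) => //.
- by move=> n [].
- by move=> n; have /andP[] := t01 n; lra.
- move=> n [n0 cn].
  have q2 : 2 <= (q n)%:R :> R by rewrite ler_nat q_gt1.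
  have := t_predM n0; have -> : (c n)%:R = (q n)%:R - 1 :> R.
    by rewrite cn -subn1 natrB// ltnW// q_gt1.
  by have /andP[_ +] := t01 n; have /andP[_] := t01 n.-1; nra.
- move=> n; have := digit_le_t (ltn0Sn n).
  by rewrite /= -natr1 mulrDl mul1r; lra.
move=> T TD nT bT; have T0 n : T n -> Npos n by move=> /TD[].
have [_ _ [T' [T'T nT' rT']] Tq] := cond T T0 nT bT
  (nullD0 _ _ (fun n Tn => supp_q_supp (TD n Tn))).
split => //; exists T'; split => //; rewrite -(subrr 1).
by apply: cvgB => //; exact: cvg_cst.
Qed.

(** At a zero digit [t n.-1 = t n / q n], so [descent] applies to [t], fed by the limit and the last
    clause of (a2). *)
Lemma exists_small_zero :
  (forall A, A `<=` Npos -> ~ null A -> q_bounded a A -> cond_zero A) ->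
  forall k S, S `<=` Npos `\` supp c -> ~ null S -> q_bounded a S ->
    exists2 n, S n & t n.-1 <= 2^-1 ^+ k.
Proof.
move=> cond k S Ss nS bS.
apply: (descent (u := t) (r := fun n => (c n.+1)%:R / (q n.+1)%:R)
  (D := Npos `\` supp c)) => //.
- by move=> n; have /andP[] := t01 n.
- move=> n [n0 nc]; have c0 : c n = 0%N by apply: contrapT => c0; apply: nc.
  have q2 : 2 <= (q n)%:R :> R by rewrite ler_nat q_gt1.
  have := t_predM n0; rewrite c0 add0r.
  by have /andP[+ _] := t01 n; have /andP[+ _] := t01 n.-1; nra.
- move=> n; have := t_le_digit (ltn0Sn n).
  by rewrite -natr1 mulrDl mul1r.
move=> T TD nT bT; have T0 n : T n -> Npos n by move=> /TD[].
have nTs : null (T `&` supp c).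
  by apply: density0_subset (density0_initial R 0%N) => n [/TD[]].
have [rT Ts] := cond T T0 nT bT nTs; split => // bT1.
apply: density0_subset (Ts bT1) => n [Tn nD]; split => //; apply: contrapT => nc.
by apply: nD; split => //; exact: shift1_Npos Tn.
Qed.

Lemma cond_stat :
  (forall A, A `<=` Npos -> ~ null A ->
    (q_bounded a A -> cond_supp A /\ cond_zero A) /\ cond_divergent A) ->
  forall e, 0 < e -> null [set n | ~ near_int e (t n.-1)].
Proof.
move=> cond e e0; apply: contrapT => nE.
have [j je] := ltr_invS e0.
(* Index 0 is dropped because the conditions only concern sets of positive indices. *)
pose E := [set n | ~ near_int e (t n.-1)] `\` [set n | (n < 1)%N].
have EN : E `<=` Npos by move=> n [_ /= /negP]; rewrite -leqNgt.
have nE' : ~ null E.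
  by apply: density_neq0_setD nE _; apply: density0_subset (density0_initial R 1) => n [].
have [k ke] : exists k : nat, 2^-1 ^+ k < e.
  exists j.+1; apply: le_lt_trans je; rewrite exprVn lef_pV2 ?posrE ?exprn_gt0//.
  by rewrite -natrX ler_nat ltnW// ltn_expl.
have condb A (AN : A `<=` Npos) nA bA := (cond A AN nA).1 bA.
(* A non-null [q]-bounded part of [E] is split by [supp c]; on a non-null half some [t n.-1] comes
   within [2^-1 ^+ k < e] of 0 or 1. *)
have [[M nM]|allM] := pselect (exists M, ~ null (E `&` [set n | (q n <= M)%N])).
  set S := E `&` _ in nM.
  have bS : q_bounded a S by exists M => n [].
  have [nSs|nSs] := pselect (null (S `&` supp c)).
    have [|||n [[[/= bad _] _] _] tn] :=
        @exists_small_zero (fun A AN nA bA => (condb A AN nA bA).2) k (S `\` supp c).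
    - by move=> n [[/EN n0 _] nc].
    - exact: density_neq0_setD nM nSs.
    - by exists M => n [[]].
    by apply: bad; left; exact: le_lt_trans ke.
  have [|||n [[[/= bad _] _] _] tn] :=
      @exists_small_supp (fun A AN nA bA => (condb A AN nA bA).1) k (S `&` supp c).
  - by move=> n [].
  - by [].
  - by exists M => n [[]].
  by apply: bad; right; lra.
(* With every bounded part null, the diagonal argument leaves a [q]-divergent [A] after removing a
   null set. *)
have nEk k0 : null (E `&` [set n | (q n <= k0)%N]).
  by apply: contrapT => h; apply: allM; exists k0.
have [A [AE nA AQ]] := density0_diagonal nEk.
have nnA := density_neq0_almost nE' nA.
have AN := subset_trans AE EN.
have qA N : exists N', forall n, (N' <= n)%N -> A n -> (N <= q n)%N.
  have [N' h] := AQ N; exists N' => n N'n An; rewrite leqNgt; apply/negP => qN.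
  by apply: (h n N'n An); exact: ltnW.
have divA : q_divergent a A.
  split; first exact: density_neq0_infinite nnA.
  by apply/cvgnyPge => N; have [N' h] := qA N; exists N' => // n /h.
have [B [BA nB Bcvg]] := (cond A AN nnA).2 divA.
have nnB := density_neq0_almost nnA nB.
have e20 : 0 < e / 2 by rewrite divr_gt0.
have [N1 _ hN1] := (cvg_circle_digit (subset_trans BA AN)).1 Bcvg _ e20.
have [i ie] := ltr_invS e20; have [N2 hN2] := qA i.+1.
have [n Bn] := density_neq0_unbounded nnB (maxn N1 N2).
rewrite geq_max => /andP[/hN1/(_ Bn) ni /hN2/(_ (BA _ Bn)) iq].
have [bad _] := AE _ (BA _ Bn); apply: bad; have n0 := AN _ (BA _ Bn).
(* By (b) [c n / q n] is near an integer, and [1 / q n] is small, so [t n.-1] is near an integer,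
   against membership in [E]. *)
apply: near_int_close ni; last by rewrite -splitr.
rewrite distrC (le_trans (t_digit_dist n0))// (le_trans _ (ltW ie))//.
by rewrite lef_pV2 ?posrE ?q_pos// ler_nat.
Qed.

End DigitDynamics.

(** * Tails of the canonical representation *)

Section ArithmeticTails.
Variable (a : nat -> nat).
Hypothesis ha : arithmetic_sequence a.
Local Notation q := (qratio a).

Lemma arith_pos n : (0 < a n)%N.
Proof.
have [a0 aS _] := ha; elim: n => [|n IH]; first by rewrite a0.
exact: ltn_trans (aS n).
Qed.

Lemma arith_qratio n : a n.+1 = (q n.+1 * a n)%N.
Proof. by have [_ _ ad] := ha; rewrite /qratio/= divnK. Qed.

Lemma qratio_gt1 n : (0 < n)%N -> (1 < q n)%N.
Proof.
case: n => // n _; have [_ /(_ n) + _] := ha; rewrite arith_qratio.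
by rewrite -{1}[a n]mul1n ltn_pmul2r// arith_pos.
Qed.

(** Take the rescaled remainders [a n * (s - p n)]. The partial sums [p n] never decrease and
    [p n + 1 / a n] never increases, because [c k + 1 <= q k]; [s] lies between the two. *)
Lemma canonical_rep_tail (R : realType) (x : circle R) c : canonical_rep a x c ->
  exists t : nat -> R, [/\ forall n, 0 <= t n <= 1,
    forall n, t n = ((c n.+1)%:R + t n.+1) / (q n.+1)%:R &
    forall n, x *+ a n = circle_of (t n)].
Proof.
move=> [cq _ [s ps xs]].
have aR n : (0 : R) < (a n)%:R by rewrite ltr0n arith_pos.
pose p n : R := \sum_(1 <= k < n.+1) (c k)%:R / (a k)%:R.
have pS n : p n.+1 = p n + (c n.+1)%:R / (a n.+1)%:R by rewrite /p big_nat_recr.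
have p_le n m : (n <= m)%N -> p n <= p m.
  elim: m => [|m IH]; first by rewrite leqn0 => /eqP ->.
  rewrite leq_eqVlt => /predU1P[->//|/IH /le_trans]; apply.
  by rewrite pS lerDl divr_ge0.
have a_inv n : (a n)%:R^-1 = (q n.+1)%:R / (a n.+1)%:R :> R.
  rewrite arith_qratio natrM invfM mulrA mulfV ?mul1r//.
  by rewrite pnatr_eq0 -lt0n ltnW// qratio_gt1.
have pa_ge n m : (n <= m)%N -> p m + (a m)%:R^-1 <= p n + (a n)%:R^-1.
  elim: m => [|m IH]; first by rewrite leqn0 => /eqP ->.
  rewrite leq_eqVlt => /predU1P[->//|/IH]; apply: le_trans.
  rewrite pS (a_inv m) -addrA lerD2l -[X in _ + X]mul1r -mulrDl.
  by rewrite ler_pM2r ?invr_gt0// natr1 ler_nat cq.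
have p_s n : p n <= s.
  rewrite -(cvg_lim _ ps)//; apply: limr_ge; first exact: cvgP ps.
  by exists n => // m; exact: p_le.
have s_pa n : s <= p n + (a n)%:R^-1.
  rewrite -(cvg_lim _ ps)//; apply: limr_le; first exact: cvgP ps.
  exists n => // m /pa_ge; apply: le_trans; by rewrite lerDl invr_ge0.
exists (fun n => (a n)%:R * (s - p n)); split => n.
- rewrite mulr_ge0 ?subr_ge0//= mulrC -ler_pdivlMr// mul1r.
  by rewrite lerBlDl.
- rewrite pS arith_qratio natrM.
  have q0 : (q n.+1)%:R != 0 :> R by rewrite pnatr_eq0 -lt0n ltnW// qratio_gt1.
  have an0 := lt0r_neq0 (aR n).
  by move: (q n.+1) q0 => Q Q0; field; rewrite Q0.
rewrite xs -circle_ofMn; apply/circle_of_eq.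
rewrite -[s *+ _]mulr_natl -mulrBr opprB addrC subrK.
(* What remains is that [a n * p n] is an integer: [a n] clears every denominator up to index
   [n]. *)
elim: n => [|n IH]; first by rewrite /p big_geq// mulr0 int_num0.
rewrite pS mulrDr [X in _ + X]mulrC divfK ?lt0r_neq0// rpredD//; last exact: natr_int.
by rewrite arith_qratio natrM -mulrA rpredM// natr_int.
Qed.

End ArithmeticTails.

(** * Torsion in terms of tails, and the equivalence *)

Lemma s_torsion_tail (R : realType) (a : nat -> nat) (x : circle R) (t : nat -> R) :
  (forall n, 0 <= t n <= 1) -> (forall n, x *+ a n = circle_of (t n)) ->
  s_torsion a x <->
  forall e, 0 < e -> has_density [set n | ~ near_int e (t n)] (0 : R).
Proof.
move=> t01 xt; split => [xs e e0|ts U].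
  have [U U0 Ue] := near_int_nbhs_circle e0.
  (* Statistical convergence only sees positive indices, so index 0 is covered by a finite set. *)
  apply: density0_subset (density0_setU (density0_initial R 1) (xs U U0)) => n far.
  case: n far => [|n] far; [by left|right; split => // Ut; apply: far].
  by apply: Ue => //; rewrite -xt.
move=> /nbhs_circle_of0 [e e0 eU]; apply: density0_subset (ts e e0) => n [_ nU] tn.
by apply: nU; rewrite /= xt; exact: eU.
Qed.

Theorem theorem2p1 (R : realType) (a : nat -> nat) (x : circle R)
    (c : nat -> nat)
    (ha : arithmetic_sequence a) (hx : canonical_rep a x c) :
  s_torsion a x <->
  (has_density (supp c) (0 : R) \/
   (0 < upper_density R (supp c) /\
    forall A : set nat, A `<=` Npos -> 0 < upper_density R A ->
      (* (a) *)
      (q_bounded a A ->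
        (* (a1) *)
        (dsubset R A (supp c) ->
          [/\ dsubset R (shift1 A) (supp c),
              dsubset R A (supp_q a c),
              exists A' : set nat,
                [/\ A' `<=` A, has_density (A `\` A') (0 : R) &
                    (c n.+1).+1%:R / (qratio a n.+1)%:R
                      @[n --> within A' \oo] --> (1 : R)]
            & q_bounded a (shift1 A) -> dsubset R (shift1 A) (supp_q a c)]) /\
        (* (a2) *)
        (has_density (A `&` supp c) (0 : R) ->
          (exists A' : set nat,
             [/\ A' `<=` A, has_density (A `\` A') (0 : R) &
                 (c n.+1)%:R / (qratio a n.+1)%:R
                   @[n --> within A' \oo] --> (0 : R)]) /\
          (q_bounded a (shift1 A) ->
             has_density (shift1 A `&` supp c) (0 : R)))) /\
      (* (b) *)
      (q_divergent a A ->
        exists B : set nat,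
          [/\ B `<=` A, has_density (A `\` B) (0 : R) &
              circle_of ((c n)%:R / (qratio a n)%:R : R)
                @[n --> within B \oo] --> (0 : circle R)]))).
Proof.
have [cq _ _] := hx; have q1 := qratio_gt1 ha.
have [t [t01 t_rec xt]] := canonical_rep_tail ha hx.
(* Digit [n] is tied to [t n.-1], hence this shift of the exceptional sets, under which density zero
   is preserved. *)
have statP : s_torsion a x <->
    forall e, 0 < e -> has_density [set n | ~ near_int e (t n.-1)] (0 : R).
  apply: iff_trans (s_torsion_tail t01 xt) _; split => ts e /ts nt.
    apply: density0_subset
      (density0_setU (density0_initial R 1) (iffRL (density0_shift1 _ _) nt)).
    by move=> [|n] far; [left|right; exists n].
  exact: density0_predset nt.
split=> [/statP ts|[ns|[_ cond]]].
- have [ns|ns] := pselect (has_density (supp c) (0 : R)); [by left|right].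
  split; first exact/upper_density_gt0.
  move=> A AN _; split=> [bA|[_ divA]]; last exact: (stat_divergent q1 cq t01 t_rec ts AN divA).
  split=> [As|As]; split.
  + exact: (stat_supp_shift q1 cq t01 t_rec ts AN bA As).
  + exact: (stat_supp_q q1 cq t01 t_rec ts AN bA As).
  + exact: (stat_supp_cvg q1 cq t01 t_rec ts AN bA As).
  (* The last clause of (a1) is its second one for [A + 1], whose premise is the first clause for
     [A]. *)
  + move=> bA1; apply: (stat_supp_q q1 cq t01 t_rec ts (@shift1_Npos A) bA1).
    exact: (stat_supp_shift q1 cq t01 t_rec ts AN bA As).
  + exact: (stat_zero_cvg q1 t01 t_rec ts AN bA As).
  + move=> bA1; exact: (stat_zero_shift q1 t01 t_rec ts AN bA bA1 As).
- by apply/(s_torsion_tail t01 xt); exact: (density0_supp_stat q1 t01 t_rec ns).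
apply/statP; apply: (cond_stat q1 cq t01 t_rec) => A AN /upper_density_gt0 nA.
by have [ab b] := cond A AN nA; split.
Qed.
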